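(* Let $f,g\in L^2(\mathbb{R}^d)$. Then for all $x,\omega\in\mathbb{R}^d$: $$W(f,g)(x,\omega)=2^d\,R_gf(x,\omega),$$ $$V_gf(x,\omega)=e^{-\pi i x\cdot\omega}\,R_{\check g}f\left(\tfrac{x}{2},\tfrac{\omega}{2}\right),$$ $$A(f,g)(x,\omega)=R_{\check g}f\left(\tfrac{x}{2},\tfrac{\omega}{2}\right).$$
   Context: Notation: $\check g(t)=g(-t)$; products such as $x\omega$ of vectors in $\mathbb{R}^d$ denote the scalar product. For $f,g\in L^2(\mathbb{R}^d)$ and $x,\omega\in\mathbb{R}^d$: - Grossmann-Royer transform: $R_gf(x,\omega)=\int_{\mathbb{R}^d}e^{4\pi i\omega\cdot(t-x)}f(2x-t)\overline{g(t)}\,dt$. - Short-time Fourier transform: $V_gf(x,\omega)=\int_{\mathbb{R}^d}e^{-2\pi i t\cdot\omega}f(t)\overline{g(t-x)}\,dt$. - Cross-Wigner distribution: $W(f,g)(x,\omega)=\int_{\mathbb{R}^d}e^{-2\pi i\omega\cdot t}f(x+\tfrac t2)\overline{g(x-\tfrac t2)}\,dt$. - Cross-ambiguity function: $A(f,g)(x,\omega)=\int_{\mathbb{R}^d}e^{-2\pi i\omega\cdot t}f(t+\tfrac x2)\overline{g(t-\tfrac x2)}\,dt$. *)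

(* Defs.v *)
From HB Require Import structures.
From mathcomp Require Import all_boot all_order all_algebra.
From mathcomp Require Import all_classical all_reals all_analysis.
From mathcomp Require Import complex.

Set Implicit Arguments.
Unset Strict Implicit.
Unset Printing Implicit Defensive.
Import Order.TTheory GRing.Theory Num.Theory.
Import numFieldNormedType.Exports.

Local Open Scope classical_set_scope.
Local Open Scope ring_scope.
Local Open Scope complex_scope.

Definition measure_rV_display : measure_display -> measure_display.
Proof. exact. Qed.

(* 'rV[T]_n carries the sigma-algebra generated by its coordinate functions,
   as n.-tuple T does; for T = R this is the Borel sigma-algebra of R^n. *)
Section measurable_rV.
Context {d} {T : measurableType d}.
Variable n : nat.

Let coors : 'I_n -> 'rV[T]_n -> T := fun i v => v ord0 i.

Let rV_set0 : g_sigma_preimage coors set0.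
Proof. exact: sigma_algebra0. Qed.

Let rV_setC A : g_sigma_preimage coors A -> g_sigma_preimage coors (~` A).
Proof. exact: sigma_algebraC. Qed.

Let rV_bigcup (F : _^nat) : (forall i, g_sigma_preimage coors (F i)) ->
  g_sigma_preimage coors (\bigcup_i (F i)).
Proof. exact: sigma_algebra_bigcup. Qed.

HB.instance Definition _ := @isMeasurable.Build (measure_rV_display d)
  'rV[T]_n (g_sigma_preimage coors) rV_set0 rV_setC rV_bigcup.

Lemma measurable_coord (i : 'I_n) :
  measurable_fun [set: 'rV[T]_n] (fun v : 'rV[T]_n => v ord0 i).
Proof.
move=> _ Y mY; rewrite setTI; apply: sub_sigma_algebra => /=.
rewrite -bigcup_seq/=; exists i => /=; first by rewrite mem_index_enum.
by exists Y => //; rewrite setTI.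
Qed.

Lemma measurable_fun_rV d' (T' : measurableType d') (f : T' -> 'rV[T]_n) :
  (forall i, measurable_fun [set: T'] (fun x => f x ord0 i)) ->
  measurable_fun [set: T'] f.
Proof.
move=> mf; have -> : measurable_fun [set: T'] f <->
    g_sigma_preimage coors `<=`
      image_set_system [set: T'] f (@measurable _ T').
  split=> [h A mA|h _ A mA]; first exact: h.
  exact: h.
apply: smallest_sub.
  exact/sigma_algebra_image/sigma_algebra_measurable.
move=> A; rewrite -bigcup_seq => -[i _ [B mB <-]].
by rewrite /image_set_system /= setTI; have := mf i measurableT B mB.
Qed.

End measurable_rV.

Section lebesgue_rV.
Context {R : realType}.

Definition consrV n (p : R * 'rV[R]_n) : 'rV[R]_n.+1 :=
  row_mx (const_mx p.1 : 'rV_1) p.2.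

Lemma consrV0 n (p : R * 'rV[R]_n) : consrV p ord0 ord0 = p.1.
Proof.
have -> : ord0 = lshift n (ord0 : 'I_1) :> 'I_(1 + n) by apply/val_inj.
by rewrite /consrV (@row_mxEl _ 1 1 n) mxE.
Qed.

Lemma consrVS n (p : R * 'rV[R]_n) i :
  consrV p ord0 (lift ord0 i) = p.2 ord0 i.
Proof.
have -> : lift ord0 i = rshift 1 i :> 'I_(1 + n) by apply/val_inj.
by rewrite /consrV (@row_mxEr _ 1 1 n).
Qed.

Lemma measurable_consrV n : measurable_fun setT (@consrV n).
Proof.
apply: measurable_fun_rV => i; have [j ->|->] := unliftP ord0 i.
  under eq_fun do rewrite consrVS.
  exact: (measurableT_comp (measurable_coord j) measurable_snd).
under eq_fun do rewrite consrV0.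
exact: measurable_fst.
Qed.

Section lebesgue_consrV.
Variables (n : nat) (mu : {sigma_finite_measure set 'rV[R]_n -> \bar R}).

Definition lebesgue_consrV : set 'rV[R]_n.+1 -> \bar R :=
  pushforward (lebesgue_measure \x mu)%E (@consrV n).

Let mc := @measurable_consrV n.

Let lebesgue_consrV0 : lebesgue_consrV set0 = 0%E.
Proof. by rewrite /lebesgue_consrV /pushforward preimage_set0 measure0. Qed.

Let lebesgue_consrV_ge0 A : (0 <= lebesgue_consrV A)%E.
Proof. exact: measure_ge0. Qed.

Let lebesgue_consrV_sigma_additive : semi_sigma_additive lebesgue_consrV.
Proof. rewrite /lebesgue_consrV; exact: measure_semi_sigma_additive. Qed.

HB.instance Definition _ := isMeasure.Build _ _ _ lebesgue_consrV
  lebesgue_consrV0 lebesgue_consrV_ge0 lebesgue_consrV_sigma_additive.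

Lemma lebesgue_consrVE (A : set R) (B : set 'rV[R]_n) (C : set 'rV[R]_n.+1) :
  measurable A -> measurable B -> @consrV n @^-1` C = A `*` B ->
  lebesgue_consrV C = (lebesgue_measure A * mu B)%E.
Proof.
by move=> mA mB CAB; rewrite /lebesgue_consrV /pushforward CAB product_measure1E.
Qed.

Let lebesgue_consrV_sigma_finite : sigma_finite setT lebesgue_consrV.
Proof.
have /sigma_finiteP[F [TF ndF Foo]] :=
  sigma_finiteT (@lebesgue_measure R : {sigma_finite_measure set _ -> \bar R}).
have /sigma_finiteP[G [TG ndG Goo]] := sigma_finiteT mu.
pose H k := [set v : 'rV[R]_n.+1 |
  F k (v ord0 ord0) /\ G k (\row_i v ord0 (lift ord0 i))].
have HE k : @consrV n @^-1` H k = F k `*` G k.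
  apply/seteqP; split=> -[x y]; rewrite /H /= consrV0;
  rewrite (_ : \row_i _ = y) //; apply/rowP => i; rewrite mxE consrVS//.
exists H.
  apply/esym; rewrite -subTset => v _.
  have [i _ Fi] : (\bigcup_k F k) (v ord0 ord0) by rewrite -TF.
  have [j _ Gj] : (\bigcup_k G k) (\row_i v ord0 (lift ord0 i)) by rewrite -TG.
  exists (maxn i j) => //; split.
    by move: Fi; exact/subsetPset/ndF/leq_maxl.
  by move: Gj; exact/subsetPset/ndG/leq_maxr.
move=> k; have [mF Fk] := Foo k; have [mG Gk] := Goo k; split.
  apply: measurableI; rewrite -[X in measurable X]setTI.
    exact: (measurable_coord ord0).
  apply: (_ : measurable_fun setT
    (fun v : 'rV[R]_n.+1 => \row_i v ord0 (lift ord0 i))) => //.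
  apply: measurable_fun_rV => i; under eq_fun do rewrite mxE.
  exact: measurable_coord.
by rewrite (lebesgue_consrVE mF mG (HE k)) lte_mul_pinfty// ge0_fin_numE.
Qed.

HB.instance Definition _ := Measure_isSigmaFinite.Build _ _ _ lebesgue_consrV
  lebesgue_consrV_sigma_finite.

End lebesgue_consrV.

Fixpoint lebesgue_rV n : {sigma_finite_measure set 'rV[R]_n -> \bar R} :=
  match n with
  | 0 => dirac (0 : 'rV[R]_0)
  | n'.+1 => lebesgue_consrV (lebesgue_rV n')
  end.

Lemma lebesgue_rV_box n (A : 'I_n -> set R) : (forall i, measurable (A i)) ->
  lebesgue_rV n [set v | forall i, A i (v ord0 i)] =
  (\prod_(i < n) lebesgue_measure (A i))%E.
Proof.
elim: n A => [A _|n ih A mA].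
  by rewrite big_ord0 /= /dirac indicE mem_set// => -[].
rewrite big_ord_recl -ih//=.
apply: lebesgue_consrVE => //.
  rewrite [X in measurable X](_ : _ = \bigcap_(i in [set: 'I_n])
    ((fun v : 'rV[R]_n => v ord0 i) @^-1` A (lift ord0 i))); last first.
    by apply/seteqP; split=> v /= h i; [move=> _|]; exact: h.
  apply: fin_bigcap_measurable => // i _.
  by rewrite -[X in measurable X]setTI; exact: measurable_coord.
apply/seteqP; split=> -[x v] /=.
  move=> h; split=> [|i]; first by have := h ord0; rewrite consrV0.
  by have := h (lift ord0 i); rewrite consrVS.
move=> -[Ax h] i; have [j ->|->] := unliftP ord0 i.
  by rewrite consrVS; exact: h.
by rewrite consrV0.
Qed.

End lebesgue_rV.

Section time_frequency.
Context {R : realType}.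

Definition dotv d (x y : 'rV[R]_d) : R := \sum_(i < d) x ord0 i * y ord0 i.

Definition cexp (z : R[i]) : R[i] :=
  (expR (complex.Re z))%:C * (cos (complex.Im z) +i* sin (complex.Im z)).

Definition Cintegral d (T : measurableType d) (mu : {measure set T -> \bar R})
    (F : T -> R[i]) : R[i] :=
  (\int[mu]_t complex.Re (F t)) +i* (\int[mu]_t complex.Im (F t)).

Definition intRd d (F : 'rV[R]_d -> R[i]) : R[i] := Cintegral (lebesgue_rV d) F.

(* Elements of L^2(R^d) are given by Borel representatives: every class of
   square-integrable Lebesgue measurable functions contains one, and none of
   the integrals below depends on its choice. *)
Definition L2 d (f : 'rV[R]_d -> R[i]) : Prop :=
  [/\ measurable_fun setT (fun t => complex.Re (f t)),
      measurable_fun setT (fun t => complex.Im (f t)) &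
      (\int[lebesgue_rV d]_t ((Normc.normc (f t)) ^+ 2)%:E < +oo)%E].

Definition reflect_fun d (g : 'rV[R]_d -> R[i]) : 'rV[R]_d -> R[i] :=
  fun t => g (- t).

(* R_g f (x, w) *)
Definition grossmann_royer d (g f : 'rV[R]_d -> R[i]) (x w : 'rV[R]_d) : R[i] :=
  intRd (fun t => cexp ((4 * pi * dotv w (t - x)) *i)
                  * f (2 *: x - t) * conjc (g t)).

(* V_g f (x, w) *)
Definition stft d (g f : 'rV[R]_d -> R[i]) (x w : 'rV[R]_d) : R[i] :=
  intRd (fun t => cexp ((- (2 * pi * dotv t w)) *i) * f t * conjc (g (t - x))).

(* W(f, g)(x, w) *)
Definition cross_wigner d (f g : 'rV[R]_d -> R[i]) (x w : 'rV[R]_d) : R[i] :=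
  intRd (fun t => cexp ((- (2 * pi * dotv w t)) *i)
                  * f (x + 2^-1 *: t) * conjc (g (x - 2^-1 *: t))).

(* A(f, g)(x, w) *)
Definition cross_ambiguity d (f g : 'rV[R]_d -> R[i]) (x w : 'rV[R]_d) : R[i] :=
  intRd (fun t => cexp ((- (2 * pi * dotv w t)) *i)
                  * f (t + 2^-1 *: x) * conjc (g (t - 2^-1 *: x))).

End time_frequency.

(* Main.v *)
(* All four transforms are Fourier integrals of products f(.) conj(g(.)), and
   the substitutions t := 2 (x - s), resp. t := x - s and t := x/2 - s, carry the
   left-hand sides to Grossmann-Royer integrals. These are instances of the
   change of variables v |-> a v + b on R^d, with Jacobian |a|^d: it holds on R
   because both sides are measures agreeing on intervals, and lifts to R^d by
   Tonelli. Beyond measurability, square integrability is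
   needed only to move the phase exp(-pi i x.w) across the integral, through the
   absolute integrability of the integrand. *)
Require Import Defs.
From HB Require Import structures.
From mathcomp Require Import all_boot all_order all_algebra.
From mathcomp Require Import all_classical all_reals all_analysis.
From mathcomp Require Import measurable_realfun.
From mathcomp Require Import complex ring lra.
Import Order.TTheory GRing.Theory Num.Theory.
Import numFieldNormedType.Exports.
Local Open Scope classical_set_scope.
Local Open Scope ring_scope.
Local Open Scope complex_scope.

(** * Affine changes of variables on the line and on R^d *)

Lemma measurable_affine {R : realType} (a b : R) :
  measurable_fun [set: R] (fun x : R => a * x + b).
Proof. by apply: measurable_funD => //; exact: measurable_funM. Qed.

(** Lebesgue measure is determined by its values on the intervals []l, r]], and the preimage of such
    an interval is an interval of length (r - l) / |a|. *)
Lemma lebesgue_measure_affine {R : realType} (a b : R) (A : set R) :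
  a != 0 -> measurable A ->
  ((`|a|%:E * lebesgue_measure ((fun x : R => (a * x + b)%R) @^-1` A))%E =
   lebesgue_measure A).
Proof.
move=> a0 mA.
pose phi : R -> measurableTypeR R := fun x => a * x + b.
have mphi : measurable_fun [set: measurableTypeR R] phi.
  exact: measurable_affine.
apply: esym.
apply: (@lebesgue_measure_unique R (mscale (`|a|%:nng)
  (pushforward lebesgue_measure phi))) => // _ [[l r]] _ <-.
change (lebesgue_measure `]l, r]%classic =
  `|a|%:E * lebesgue_measure (phi @^-1` `]l, r]%classic))%E.
have [a_gt0|a_lt0] : 0 < a \/ a < 0.
  by move: a0; rewrite neq_lt => /orP[]; [right|left].
- have -> : phi @^-1` `]l, r] = `](l - b) / a, (r - b) / a]%classic.
    apply/seteqP; split => x /=; rewrite /phi !in_itv/=;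
    by rewrite ltr_pdivrMr// ler_pdivlMr// ltrBlDr lerBrDr mulrC.
  rewrite !lebesgue_measure_itv/= !lte_fin ltr_pM2r ?invr_gt0// ltrD2r.
  case: ifPn => _; last by rewrite mule0.
  by rewrite !EFinN -!EFinB -EFinM gtr0_norm//; congr EFin; field.
(* A negative slope reverses the order, so the open and closed ends trade places; the length does
   not see this. *)
- have -> : phi @^-1` `]l, r] = `[(r - b) / a, (l - b) / a[%classic.
    apply/seteqP; split => x /=; rewrite /phi !in_itv/=;
    by rewrite ltr_ndivlMr// ler_ndivrMr// ltrBlDr lerBrDr mulrC andbC.
  rewrite !lebesgue_measure_itv/= !lte_fin ltr_nM2r ?invr_lt0// ltrD2r.
  case: ifPn => _; last by rewrite mule0.
  by rewrite !EFinN -!EFinB -EFinM ltr0_norm//; congr EFin; field.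
Qed.

(** Lebesgue measure is |a| times its own image under the affine map, and integrating against an
    image measure means integrating the composite. *)
Lemma ge0_integral_affine {R : realType} (a b : R) (f : R -> \bar R) :
  a != 0 -> measurable_fun setT f -> (forall x, 0 <= f x)%E ->
  (`|a|%:E * \int[lebesgue_measure]_x f (a * x + b)%R =
   \int[lebesgue_measure]_x f x)%E.
Proof.
move=> a0 mf f0.
pose phi : measurableTypeR R -> measurableTypeR R := fun x => a * x + b.
have mphi : measurable_fun [set: measurableTypeR R] phi.
  exact: measurable_affine.
rewrite [RHS](eq_measure_integral (mscale (`|a|%:nng)%R
  (pushforward lebesgue_measure phi))) //.
  by move=> *; rewrite ge0_integral_mscale// ge0_integral_pushforward.
by move=> *; apply/esym/lebesgue_measure_affine.
Qed.

(** By construction the measure in dimension [n.+1] is the image of a product measure under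
    [consrV], so Tonelli splits off the first coordinate. *)
Lemma ge0_integral_lebesgue_rVS {R : realType} {n : nat}
    (f : 'rV[R]_n.+1 -> \bar R) :
  measurable_fun setT f -> (forall v, 0 <= f v)%E ->
  (\int[lebesgue_rV n.+1]_v f v =
   \int[lebesgue_measure]_x \int[lebesgue_rV n]_v f (consrV (x, v)))%E.
Proof.
move=> mf f0; rewrite /= /lebesgue_consrV.
rewrite ge0_integral_pushforward//; last exact: measurable_consrV.
rewrite preimage_setT fubini_tonelli1// => [|p]; last exact: f0.
by apply: measurableT_comp => //; exact: measurable_consrV.
Qed.

Lemma measurable_integral_consrV {R : realType} {n : nat}
    (f : 'rV[R]_n.+1 -> \bar R) :
  measurable_fun setT f -> (forall v, 0 <= f v)%E ->
  measurable_fun setT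
    (fun x : R => \int[lebesgue_rV n]_v f (consrV (x, v)))%E.
Proof.
move=> mf f0.
apply: (measurable_fun_fubini_tonelli_F (m2 := lebesgue_rV n)
  (f \o @consrV R n)) => [|p]; last exact: f0.
exact: measurableT_comp mf (@measurable_consrV R n).
Qed.

Lemma measurable_consrVr {R : realType} {n : nat} (x : R) :
  measurable_fun setT (fun v : 'rV[R]_n => consrV (x, v)).
Proof.
apply: measurable_fun_rV => i; have [j ->|->] := unliftP ord0 i.
  by under eq_fun do rewrite consrVS; exact: measurable_coord.
by under eq_fun do rewrite consrV0 /=; exact: measurable_cst.
Qed.

Lemma measurable_affine_rV {R : realType} {n : nat} (a : R) (b : 'rV[R]_n) :
  measurable_fun setT (fun v : 'rV[R]_n => a *: v + b).
Proof.
apply: measurable_fun_rV => i; under eq_fun do rewrite !mxE.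
apply: measurableT_comp (measurable_affine a (b ord0 i)) (measurable_coord i).
Qed.

(** Induction on the dimension: the first coordinate contributes one factor |a| through the scalar
    case, the remaining ones contribute |a|^n. *)
Lemma ge0_integral_affine_rV {R : realType} {n : nat} (a : R) (b : 'rV[R]_n)
    (f : 'rV[R]_n -> \bar R) :
  a != 0 -> measurable_fun setT f -> (forall v, 0 <= f v)%E ->
  ((`|a| ^+ n)%:E * \int[lebesgue_rV n]_v f (a *: v + b)%R =
   \int[lebesgue_rV n]_v f v)%E.
Proof.
move=> a0; elim: n b f => [|n ih] b f mf f0.
  rewrite expr0 mul1e; apply: eq_integral => v _; congr f.
  by apply/rowP => -[].
have mfa : measurable_fun setT (fun v : 'rV[R]_n.+1 => f (a *: v + b)).
  exact: measurableT_comp mf (measurable_affine_rV a b).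
rewrite !ge0_integral_lebesgue_rVS//.
pose b' : 'rV[R]_n := \row_i b ord0 (lift ord0 i).
(* The map acts coordinate by coordinate, hence respects the splitting into first coordinate and
   tail. *)
have affE x v : a *: consrV (x, v) + b =
    consrV (a * x + b ord0 ord0, a *: v + b').
  apply/rowP => i; rewrite [LHS]mxE [X in X + _]mxE.
  have [j ->|->] := unliftP ord0 i.
    by rewrite !consrVS !mxE.
  by rewrite !consrV0.
pose F x := (\int[lebesgue_rV n]_v f (consrV (x, v)))%E.
have mF : measurable_fun setT F.
  exact: measurable_integral_consrV.
have F0 x : (0 <= F x)%E by exact: integral_ge0.
rewrite -(ge0_integral_affine _ (b ord0 ord0) _ a0 mF F0).
rewrite exprS EFinM -muleA -ge0_integralZl//; last 2 first.
- exact: (measurable_integral_consrV _ mfa (fun v => f0 _)).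
- by move=> x _; exact: integral_ge0.
congr (_ * _)%E; apply: eq_integral => x _.
rewrite /F -[RHS](ih b')//; last first.
  exact: measurableT_comp mf (measurable_consrVr _).
by congr (_ * _)%E; apply: eq_integral => v _; rewrite affE.
Qed.

(** Positive and negative parts commute with the substitution, so the nonnegative case applies to
    each. *)
Lemma Rintegral_affine_rV {R : realType} {n : nat} (a : R) (b : 'rV[R]_n)
    (f : 'rV[R]_n -> R) :
  a != 0 -> measurable_fun setT f ->
  `|a| ^+ n * (\int[lebesgue_rV n]_v f (a *: v + b)) =
   \int[lebesgue_rV n]_v f v.
Proof.
move=> a0 /measurable_EFinP mf; rewrite /Rintegral.
have a_gt0 : 0 < `|a| ^+ n by rewrite exprn_gt0// normr_gt0.
rewrite [in RHS]integralE [in LHS]integralE.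
rewrite -(ge0_integral_affine_rV _ b _ a0 (measurable_funepos mf))//.
rewrite -(ge0_integral_affine_rV _ b _ a0 (measurable_funeneg mf))//.
pose P := (\int[lebesgue_rV n]_v ((EFin \o f)^\+ (a *: v + b)%R))%E.
pose N := (\int[lebesgue_rV n]_v ((EFin \o f)^\- (a *: v + b)%R))%E.
rewrite -/P -/N.
have -> : (\int[lebesgue_rV n]_v
    (EFin \o (fun v => f (a *: v + b)%R))^\+ v = P)%E.
  by apply: eq_integral => v _; rewrite !funeposE.
have -> : (\int[lebesgue_rV n]_v
    (EFin \o (fun v => f (a *: v + b)%R))^\- v = N)%E.
  by apply: eq_integral => v _; rewrite !funenegE.
have [P0 N0] : (0 <= P /\ 0 <= N)%E by split; exact: integral_ge0.
(* [fine] sends infinite values to 0, so both sides vanish if P or N is +oo. *)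
move: P N P0 N0 => [p| |] [q| |]//= _ _.
- by rewrite mulrBr.
- by rewrite gt0_muley ?lte_fin//= mulr0.
- by rewrite gt0_muley ?lte_fin//= mulr0.
- by rewrite gt0_muley ?lte_fin//= mulr0.
Qed.

(** * Moduli and unimodular phases *)

Lemma sqr_normc {R : rcfType} (z : R[i]) :
  Normc.normc z ^+ 2 = complex.Re z ^+ 2 + complex.Im z ^+ 2.
Proof. by case: z => a b /=; rewrite sqr_sqrtr// addr_ge0// sqr_ge0. Qed.

(** The squares of [a - c], [a + c], [b - d], [b + d] are nonnegative, which bounds 2|ac| and 2|bd|.
    Applied to real and imaginary parts, this dominates a product by the sum of the squared moduli
    of its factors. *)
Lemma ler_norm_mulB {R : realDomainType} (a b c d : R) :
  `|a * c - b * d| <= a ^+ 2 + b ^+ 2 + (c ^+ 2 + d ^+ 2).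
Proof.
have := (sqr_ge0 (a - c), sqr_ge0 (a + c), sqr_ge0 (b - d), sqr_ge0 (b + d)).
by case=> -[[]]; rewrite ler_norml => ? ? ? ?; apply/andP; split; nra.
Qed.

Lemma cexpDi {R : realType} (p q : R) :
  cexp ((p + q) *i) = cexp (p *i) * cexp (q *i).
Proof.
rewrite /cexp /= cosD sinD expR0; apply/eqP.
by rewrite eq_complex /=; apply/andP; split; apply/eqP; ring.
Qed.

Lemma sqr_normc_cexpi {R : realType} (p : R) (z : R[i]) :
  Normc.normc (cexp (p *i) * z) ^+ 2 = Normc.normc z ^+ 2.
Proof.
rewrite !sqr_normc /cexp /= expR0; case: z => a b /=.
by have := cos2Dsin2 p; nra.
Qed.

(** * Bilinearity, symmetry and measurability of the scalar product *)

Section dotv_theory.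
Context {R : realType} {d : nat}.
Implicit Types x y z : 'rV[R]_d.

Lemma dotvC x y : dotv x y = dotv y x.
Proof. by apply: eq_bigr => i _; rewrite mulrC. Qed.

Lemma dotvDr x y z : dotv x (y + z) = dotv x y + dotv x z.
Proof. by rewrite -big_split; apply: eq_bigr => i _; rewrite mxE mulrDr. Qed.

Lemma dotvZr a x y : dotv x (a *: y) = a * dotv x y.
Proof. by rewrite /dotv mulr_sumr; apply: eq_bigr => i _; rewrite mxE mulrCA. Qed.

Lemma dotvZl a x y : dotv (a *: x) y = a * dotv x y.
Proof. by rewrite dotvC dotvZr dotvC. Qed.

Lemma dotvNr x y : dotv x (- y) = - dotv x y.
Proof. by rewrite -scaleN1r dotvZr mulN1r. Qed.

Lemma measurable_dotv x : measurable_fun setT (dotv x).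
Proof.
apply: measurable_sum => i; apply: measurable_funM => //.
exact: measurable_coord.
Qed.

End dotv_theory.

(** * Stability of square integrability, and integrability of products *)

Section square_integrable.
Context {R : realType} {d : nat}.
Implicit Types f g : 'rV[R]_d -> R[i].

Lemma measurable_sqr_normc f :
  measurable_fun setT (fun t => complex.Re (f t)) ->
  measurable_fun setT (fun t => complex.Im (f t)) ->
  measurable_fun setT (fun t => (Normc.normc (f t) ^+ 2)%:E).
Proof.
move=> mRe mIm; apply/measurable_EFinP; under eq_fun do rewrite sqr_normc.
by apply: measurable_funD; apply: measurable_funX.
Qed.

Lemma L2_affine f (a : R) (b : 'rV[R]_d) : a != 0 -> L2 f ->
  L2 (fun t => f (a *: t + b)).
Proof.
move=> a0 [mRe mIm foo].
have mab := measurable_affine_rV a b.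
split; [exact: measurableT_comp mRe mab|exact: measurableT_comp mIm mab|].
have mf := measurable_sqr_normc _ mRe mIm.
rewrite -(ge0_integral_affine_rV a b _ a0 mf) in foo; last first.
  by move=> v; rewrite lee_fin sqr_ge0.
(* If the transformed integral were infinite, its positive multiple in [foo] would be infinite
   too. *)
move: foo; set I := (\int[_]__ _)%E; case: I => [r _|foo|]; rewrite ?ltry ?ltNyr//.
by move: foo; rewrite gt0_muley// lte_fin exprn_gt0// normr_gt0.
Qed.

Lemma L2_reflect f : L2 f -> L2 (reflect_fun f).
Proof.
move=> /(@L2_affine _ (-1) 0); rewrite oppr_eq0 oner_eq0 => /(_ isT).
by under eq_fun do rewrite scaleN1r addr0.
Qed.

Lemma L2_conjc f : L2 f -> L2 (fun t => conjc (f t)).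
Proof.
move=> [mRe mIm foo].
have ReE t : complex.Re (conjc (f t)) = complex.Re (f t) by case: (f t).
have ImE t : complex.Im (conjc (f t)) = - complex.Im (f t) by case: (f t).
split; [by under eq_fun do rewrite ReE| |].
  by under eq_fun do rewrite ImE; exact: measurable_funN.
by under eq_integral do rewrite sqr_normc ReE ImE sqrrN -sqr_normc.
Qed.

Lemma L2_cexpM f (p : 'rV[R]_d -> R) : measurable_fun setT p -> L2 f ->
  L2 (fun t => cexp ((p t) *i) * f t).
Proof.
move=> mp [mRe mIm foo].
have mcos : measurable_fun setT (fun t => cos (p t)).
  apply: measurableT_comp mp; apply: continuous_measurable_fun.
  exact: continuous_cos.
have msin : measurable_fun setT (fun t => sin (p t)).
  apply: measurableT_comp mp; apply: continuous_measurable_fun.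
  exact: continuous_sin.
split; last by under eq_integral do rewrite sqr_normc_cexpi.
- have ReE t : complex.Re (cexp ((p t) *i) * f t) =
      cos (p t) * complex.Re (f t) - sin (p t) * complex.Im (f t).
    by rewrite /cexp /= expR0; case: (f t) => a b /=; ring.
  under eq_fun do rewrite ReE.
  by apply: measurable_funB; exact: measurable_funM.
- have ImE t : complex.Im (cexp ((p t) *i) * f t) =
      cos (p t) * complex.Im (f t) + sin (p t) * complex.Re (f t).
    by rewrite /cexp /= expR0; case: (f t) => a b /=; ring.
  under eq_fun do rewrite ImE.
  by apply: measurable_funD; exact: measurable_funM.
Qed.

Lemma L2M_integrable f g : L2 f -> L2 g ->
  (lebesgue_rV d).-integrable setT (EFin \o (fun t => complex.Re (f t * g t))) /\
  (lebesgue_rV d).-integrable setT (EFin \o (fun t => complex.Im (f t * g t))).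
Proof.
move=> [mf1 mf2 foo] [mg1 mg2 goo].
pose s f : 'rV[R]_d -> \bar R := fun t => (Normc.normc (f t) ^+ 2)%:E.
have int_s h : measurable_fun setT (fun t => complex.Re (h t)) ->
    measurable_fun setT (fun t => complex.Im (h t)) ->
    (\int[lebesgue_rV d]_t s h t < +oo)%E ->
    (lebesgue_rV d).-integrable setT (s h).
  move=> m1 m2 hoo; apply/integrableP; split; first exact: measurable_sqr_normc.
  by under eq_integral do rewrite gee0_abs ?lee_fin ?sqr_ge0//.
have int_fg := integrableD measurableT (int_s f mf1 mf2 foo)
  (int_s g mg1 mg2 goo).
have ReE t : complex.Re (f t * g t) = complex.Re (f t) * complex.Re (g t) -
    complex.Im (f t) * complex.Im (g t) by case: (f t) (g t) => ? ? [].
have ImE t : complex.Im (f t * g t) = complex.Re (f t) * complex.Im (g t) +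
    complex.Im (f t) * complex.Re (g t) by case: (f t) (g t) => ? ? [].
split; apply: (le_integrable measurableT _ _ int_fg).
- apply/measurable_EFinP; under eq_fun do rewrite ReE.
  by apply: measurable_funB; exact: measurable_funM.
- move=> t _; rewrite /s /= lee_fin [leRHS]ger0_norm ?addr_ge0 ?sqr_ge0//.
  by rewrite ReE !sqr_normc; exact: ler_norm_mulB.
- apply/measurable_EFinP; under eq_fun do rewrite ImE.
  by apply: measurable_funD; exact: measurable_funM.
- move=> t _; rewrite /s /= lee_fin [leRHS]ger0_norm ?addr_ge0 ?sqr_ge0//.
  (* The sum is turned into a difference by negating the imaginary part of [f], and the two squares
     of [g] are swapped, to match the pointwise bound. *)
  rewrite ImE !sqr_normc -[X in _ + X * _]opprK mulNr.
  rewrite -(sqrrN (complex.Im (f t))) [X in _ <= _ + X]addrC.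
  exact: ler_norm_mulB.
Qed.

End square_integrable.

(** * Complex integrals and the Grossmann-Royer kernel *)

Lemma CintegralZl {d} {T : measurableType d} {R : realType}
    (mu : {measure set T -> \bar R}) (c : R[i]) (F : T -> R[i]) :
  mu.-integrable setT (EFin \o (fun t => complex.Re (F t))) ->
  mu.-integrable setT (EFin \o (fun t => complex.Im (F t))) ->
  Cintegral mu (fun t => c * F t) = c * Cintegral mu F.
Proof.
case: c => p q iRe iIm.
have ReE t : complex.Re ((p +i* q) * F t) =
    p * complex.Re (F t) - q * complex.Im (F t) by case: (F t).
have ImE t : complex.Im ((p +i* q) * F t) =
    p * complex.Im (F t) + q * complex.Re (F t) by case: (F t).
rewrite /Cintegral; apply/eqP; rewrite eq_complex /=.
under eq_Rintegral do rewrite ReE.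
under [X in _ && (X == _)]eq_Rintegral do rewrite ImE.
(* Multiplication by [c] mixes real and imaginary parts, so each real integral has to be split by
   additivity, for which the scaled parts must be integrable. *)
have Z r h : mu.-integrable setT (EFin \o h) ->
    mu.-integrable setT (EFin \o (fun t => r * h t)).
  by move=> ih; have := integrableZl measurableT r ih.
rewrite RintegralB//; [|exact: Z|exact: Z].
rewrite RintegralD//; [|exact: Z|exact: Z].
by rewrite !RintegralZl// !eqxx.
Qed.

Lemma intRd_affine {R : realType} {d : nat} (a : R) (b : 'rV[R]_d)
    (F : 'rV[R]_d -> R[i]) : a != 0 ->
  measurable_fun setT (fun t => complex.Re (F t)) ->
  measurable_fun setT (fun t => complex.Im (F t)) ->
  (`|a| ^+ d)%:C * intRd (fun t => F (a *: t + b)) = intRd F.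
Proof.
move=> a0 mRe mIm; rewrite /intRd /Cintegral.
rewrite -(Rintegral_affine_rV a b _ a0 mRe) -(Rintegral_affine_rV a b _ a0 mIm).
by apply/eqP; rewrite eq_complex /= !mul0r subr0 addr0 !eqxx.
Qed.

(** Grossmann-Royer integrands have this shape, with [y] twice the space variable. The reflected
    translate of [f] stays square integrable, as it does after multiplication by a phase. *)
Lemma phase_kernel_integrable {R : realType} {d : nat}
    (f g : 'rV[R]_d -> R[i]) (p : 'rV[R]_d -> R) (y : 'rV[R]_d) :
  measurable_fun setT p -> L2 f -> L2 g ->
  let K := fun t => cexp ((p t) *i) * f (y - t) * conjc (g t) in
  (lebesgue_rV d).-integrable setT (EFin \o (fun t => complex.Re (K t))) /\
  (lebesgue_rV d).-integrable setT (EFin \o (fun t => complex.Im (K t))).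
Proof.
move=> mp hf hg; apply: L2M_integrable; last exact: L2_conjc.
apply: L2_cexpM => //.
have N1 : -1 != 0 :> R by rewrite oppr_eq0 oner_eq0.
move: (L2_affine f (-1) y N1 hf).
by under eq_fun do rewrite scaleN1r addrC.
Qed.

(** The constant [a] leaves room for a prefactor absorbed into the phase. *)
Lemma measurable_phase {R : realType} {d : nat} (a b : R) (w x : 'rV[R]_d) :
  measurable_fun setT (fun t : 'rV[R]_d => a + b * dotv w (t - x)).
Proof.
under eq_fun do rewrite dotvDr.
apply: measurable_funD => //; apply: measurable_funM => //.
by apply: measurable_funD => //; exact: measurable_dotv.
Qed.

(** * The three identities, each by one affine substitution *)

Theorem lemma1 (R : realType) (d : nat) (f g : 'rV[R]_d -> R[i])
    (hf : L2 f) (hg : L2 g) (x w : 'rV[R]_d) :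
  [/\ cross_wigner f g x w = 2 ^+ d * grossmann_royer g f x w,
      stft g f x w = cexp ((- (pi * dotv x w)) *i)
        * grossmann_royer (reflect_fun g) f (2^-1 *: x) (2^-1 *: w) &
      cross_ambiguity f g x w
        = grossmann_royer (reflect_fun g) f (2^-1 *: x) (2^-1 *: w)].
Proof.
have N1 : -1 != 0 :> R by rewrite oppr_eq0 oner_eq0.
have meas (h : 'rV[R]_d -> R) : (lebesgue_rV d).-integrable setT (EFin \o h) ->
    measurable_fun setT h.
  by move=> /measurable_int/measurable_EFinP.
have mp b (y z : 'rV[R]_d) :
    measurable_fun setT (fun t : 'rV[R]_d => b * dotv y (t - z)).
  by have := measurable_phase 0 b y z; under eq_fun do rewrite add0r.
have normN1 : (`|-1 : R| ^+ d)%:C = 1 by rewrite normrN1 expr1n.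
(* Used with [y] equal to [x] for the short-time Fourier transform and to x/2 for the ambiguity
   function. *)
have phaseE (t y : 'rV[R]_d) : 4 * pi * dotv (2^-1 *: w) (- t + y - 2^-1 *: x) =
    2 * pi * (dotv w y - dotv w t) - pi * dotv x w.
  by rewrite dotvZl !dotvDr !dotvNr dotvZr (dotvC x w); field.
split.
(* The Grossmann-Royer variable becomes x - t/2; the Jacobian 2^-d cancels the factor 2^d. *)
- have a0 : - 2^-1 != 0 :> R by rewrite oppr_eq0 invr_eq0.
  have [iRe iIm] := phase_kernel_integrable f g _ (2 *: x)
    (mp (4 * pi) w x) hf hg.
  rewrite /grossmann_royer -(intRd_affine _ x _ a0 (meas _ iRe) (meas _ iIm)).
  rewrite normrN ger0_norm ?invr_ge0//.
  have -> : 2 ^+ d = (2 ^+ d)%:C :> R[i] by rewrite rmorphXn rmorph_nat.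
  rewrite mulrA -rmorphM/= -exprMn divff// expr1n mul1r.
  congr intRd; apply/funext => t; congr (cexp (_ *i) * f _ * conjc (g _)).
  + by rewrite addrK dotvZr; field.
  + by apply/rowP => i; rewrite !mxE; ring.
  + by apply/rowP => i; rewrite !mxE; ring.
- have [iRe iIm] := phase_kernel_integrable f (reflect_fun g) _
    (2 *: (2^-1 *: x)) (mp (4 * pi) (2^-1 *: w) (2^-1 *: x))
    hf (L2_reflect _ hg).
  (* Two kernels occur: the plain one, integrable so that the prefactor can enter the integral, and
     the one with the prefactor in its phase, to which the substitution applies. *)
  have [jRe jIm] := phase_kernel_integrable f (reflect_fun g) _
    (2 *: (2^-1 *: x))
    (measurable_phase (- (pi * dotv x w)) (4 * pi) (2^-1 *: w) (2^-1 *: x))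
    hf (L2_reflect _ hg).
  rewrite /grossmann_royer /intRd -(CintegralZl _ _ _ iRe iIm).
  pose K t := cexp ((- (pi * dotv x w)
      + 4 * pi * dotv (2^-1 *: w) (t - 2^-1 *: x)) *i)
    * f (2 *: (2^-1 *: x) - t) * conjc (reflect_fun g t).
  transitivity (intRd K); last first.
    by congr Cintegral; apply/funext => t; rewrite /K cexpDi !mulrA.
  (* With x - t as new variable, the phase gains pi x.w, which the absorbed prefactor cancels. *)
  rewrite -(intRd_affine _ x _ N1 (meas _ jRe) (meas _ jIm)).
  rewrite normN1 mul1r.
  congr intRd; apply/funext => t; congr (cexp (_ *i) * f _ * conjc (g _)).
  + by rewrite scaleN1r phaseE (dotvC t) (dotvC x); ring.
  + by apply/rowP => i; rewrite !mxE; field.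
  + by apply/rowP => i; rewrite !mxE; ring.
- have [iRe iIm] := phase_kernel_integrable f (reflect_fun g) _
    (2 *: (2^-1 *: x)) (mp (4 * pi) (2^-1 *: w) (2^-1 *: x))
    hf (L2_reflect _ hg).
  rewrite /grossmann_royer.
  (* Centring the reflection at x/2 makes the constant part of the phase vanish, so no prefactor
     remains. *)
  rewrite -[RHS](intRd_affine _ (2^-1 *: x) _ N1 (meas _ iRe) (meas _ iIm)).
  rewrite normN1 mul1r.
  congr intRd; apply/funext => t; congr (cexp (_ *i) * f _ * conjc (g _)).
  + by rewrite scaleN1r phaseE dotvZr (dotvC x); field.
  + by apply/rowP => i; rewrite !mxE; field.
  + by apply/rowP => i; rewrite !mxE; ring.
Qed.
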